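(* Let $\mu$ be a complex Borel measure on $\mathbb{T}^D$, let $n_1,\dots,n_{2D}\in\mathbb{C}^{2D}$ be linearly independent, $q_1,\dots,q_{2D}\in\mathbb{C}$, and suppose the evolved measures $d\mu_{\mathbf m}=\prod_{a=1}^{2D}(L_{n_a}(z)-q_a)^{m_a}d\mu$, $\mathbf m\in\mathbb{Z}_{\ge0}^{2D}$, are quasi-definite. Then the matrices $H_{[k]}=H_{[k]}(\mathbf m)$ satisfy the discrete Toda type equations $$\Delta_b\big((T_aH_{[k]})H_{[k]}^{-1}\big)=(\nu_a)_{[k],[k+1]}H_{[k+1]}(\nu_b)_{[k+1],[k]}(T_bH_{[k]}^{-1})-(T_aH_{[k]})(\nu_b)_{[k],[k-1]}(T_aT_bH_{[k-1]}^{-1})(\nu_a)_{[k-1],[k]},$$ or equivalently $$\Delta_b\big(H_{[k]}^{-1}T_aH_{[k]}\big)=(T_bH_{[k]}^{-1})(\nu_b)_{[k],[k+1]}H_{[k+1]}(\nu_a)_{[k+1],[k]}-(\nu_a)_{[k],[k-1]}(T_aT_bH_{[k-1]}^{-1})(\nu_b)_{[k-1],[k]}(T_aH_{[k]}),$$ for any $a,b\in\{1,\dots,D\}$ (for $k=0$ the terms containing the block index $-1$ are absent).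
   Context: Let $D\ge1$, $z(\theta)=(e^{i\theta_1},\dots,e^{i\theta_D})$. For $\alpha\in\mathbb{Z}^D$ put $|\alpha|=\sum_a|\alpha_a|$, $z^\alpha=\prod_a z_a^{\alpha_a}$, $[k]=\{\alpha:|\alpha|=k\}$. Multi-indices are ordered by $|\alpha|$ and lexicographically inside each $[k]$; $\chi(z)$ is the semi-infinite column of all monomials in this order. Semi-infinite matrices have the corresponding block structure $A_{[k],[l]}$; $A^{[k]}$ denotes truncation to blocks $0,\dots,k-1$. The moment matrix of a measure is $G=\oint_{\mathbb{T}^D}\chi(z(\theta))d\mu(\theta)\chi(z(\theta))^\dagger$; the measure is quasi-definite if $\det G^{[k]}\ne0$ for all $k\ge1$, and then uniquely $G=S^{-1}H(\hat S^{-1})^\dagger$ with $S,\hat S$ block lower unitriangular and $H=\operatorname{diag}(H_{[0]},H_{[1]},\dots)$ with invertible blocks. $H(\mathbf m)$ is the factor for $d\mu_{\mathbf m}$. Spectral matrices: $(\Upsilon_b)_{\beta,\gamma}=\delta_{\beta+e_b,\gamma}$, $\Upsilon_b^{-1}=\Upsilon_b^\top$. With $n_a=(n_{a,-1},\dots,n_{a,-D},n_{a,D},\dots,n_{a,1})^\top$, $L_{n_a}(z)=\sum_{b=1}^D(n_{a,-b}z_b^{-1}+n_{a,b}z_b)$ and $\nu_a=L_{n_a}(\Upsilon)=\sum_{b=1}^D(n_{a,-b}\Upsilon_b^{-1}+n_{a,b}\Upsilon_b)$. $T_a$ is the shift $m_a\mapsto m_a+1$ acting on functions of $\mathbf m$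 ($T_aH_{[k]}^{-1}$ means $(T_aH_{[k]})^{-1}$), and $\Delta_b=T_b-1$. *)

(* Defs.v *)
From HB Require Import structures.
From mathcomp Require Import all_boot all_order all_algebra.
From mathcomp Require Import zify complex spectral sesquilinear.
From mathcomp Require Import all_classical all_reals all_analysis.

Set Implicit Arguments.
Unset Strict Implicit.
Unset Printing Implicit Defensive.

Import Order.TTheory GRing.Theory Num.Theory.
Import numFieldNormedType.Exports.

Local Open Scope classical_set_scope.
Local Open Scope ring_scope.
Local Open Scope sesquilinear_scope.

(** Complex Borel measures on the torus.  A point of the torus is given by its
    angles: [z] is a Borel isomorphism from the box [[0, 2pi[^D] onto the torus,
    so a complex Borel measure on the torus is one on that box.  The measures
    below live on [R^D] with the Borel sigma-algebra (generated by the
    coordinates) and are only ever integrated over the box. *)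

Notation angles R D := (D.-tuple (measurableTypeR R)).

Definition torus (R : realType) (D : nat) : set (angles R D) :=
  [set theta | forall a : 'I_D, 0 <= tnth theta a < 2 * pi].

(* Charges are finite-valued and sigma-additive, so that a pair of them is a
   complex measure. *)
Record complex_measure (R : realType) (D : nat) := ComplexMeasure {
  re_part : {charge set (angles R D) -> \bar R} ;
  im_part : {charge set (angles R D) -> \bar R} }.

(* The Hahn decomposition is unique up to null sets, so that the value does not
   depend on the one that is chosen. *)
Definition charge_integral d (T : measurableType d) (R : realType)
    (nu : {charge set T -> \bar R}) (A : set T) (f : T -> R) : R :=
  let hP := cid (Hahn_decomposition nu) in
  let hN := cid (projT2 hP) in
  let nuPN := projT2 hN in
  (\int[jordan_pos nuPN]_(x in A) f x - \int[jordan_neg nuPN]_(x in A) f x)%R.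

Definition torus_integral (R : realType) (D : nat) (mu : complex_measure R D)
    (f : angles R D -> R[i]) : R[i] :=
  let I nu g := charge_integral nu (@torus R D) g in
  let u t := complex.Re (f t) in
  let v t := complex.Im (f t) in
  ((I (re_part mu) u - I (im_part mu) v)
     +i* (I (re_part mu) v + I (im_part mu) u))%C.

Section Torus.
Variables (R : realType) (D : nat).

Definition zcoord (theta : angles R D) (a : 'I_D) : R[i] :=
  (cos (tnth theta a) +i* sin (tnth theta a))%C.

Definition monomial (alpha : 'rV[int]_D) (theta : angles R D) : R[i] :=
  \prod_(a < D) zcoord theta a ^ alpha 0 a.

End Torus.

(** Multi-indices *)

Definition mnorm (D : nat) (alpha : 'rV[int]_D) : nat :=
  (\sum_(a < D) `|alpha 0%R a|)%N.

Definition lexle (D : nat) (alpha beta : 'rV[int]_D) : bool :=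
  (([seq alpha 0 a | a <- enum 'I_D] : Order.SeqLexiOrder.type_ int)
     <= [seq beta 0 a | a <- enum 'I_D])%O.

(* The multi-indices of norm k, all of which have entries in [-k, k], in
   increasing lexicographic order. *)
Definition shell (D k : nat) : seq 'rV[int]_D :=
  sort (@lexle D)
    [seq alpha <- [seq \row_a ((f a : nat)%:Z - k%:Z)
                  | f : {ffun 'I_D -> 'I_(k + k).+1}]
    | mnorm alpha == k].

Lemma mem_shell (D k : nat) (alpha : 'rV[int]_D) :
  (alpha \in shell D k) = (mnorm alpha == k).
Proof.
rewrite mem_sort mem_filter; case: eqP => //= hk.
have le_k a : (`|alpha 0%R a| <= k)%N by rewrite -hk /mnorm (bigD1 a)//= leq_addr.
have lt_k a : (absz (alpha 0%R a + k%:Z)%R < (k + k).+1)%N.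
  by have := le_k a; lia.
apply/fintype.imageP; exists [ffun a => Ordinal (lt_k a)] => //.
by apply/rowP => a; rewrite mxE ffunE /=; have := le_k a; lia.
Qed.

Lemma shell_uniq (D k : nat) : uniq (shell D k).
Proof.
rewrite sort_uniq filter_uniq// map_inj_uniq ?enum_uniq// => f g.
move=> /rowP fg; apply/ffunP => a; have := fg a; rewrite !mxE.
by move=> /addIr [] /val_inj.
Qed.

(** Semi-infinite matrices, with their entries indexed by multi-indices *)

Definition smatrix (C : Type) (D : nat) : Type :=
  'rV[int]_D -> 'rV[int]_D -> C.

Section SemiInfinite.
Variables (C : numClosedFieldType) (D : nat).
Implicit Types A G S H : smatrix C D.

Definition block A (k l : nat) : 'M[C]_(size (shell D k), size (shell D l)) :=
  \matrix_(i, j) A (nth 0 (shell D k) i) (nth 0 (shell D l) j).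

Definition trunc A (k : nat) : 'M[C]_(\sum_(i < k) size (shell D i)) :=
  \mxblock_(i < k, j < k) block A i j.

Definition lower_unitriangular A : Prop :=
  (forall k l, (k < l)%N -> block A k l = 0) /\
  (forall k, block A k k = 1%:M).

Definition block_diagonal A : Prop :=
  forall k l, k != l -> block A k l = 0.

(* [G = S^-1 H (Sh^-1)^dagger].  Block lower triangular, diagonal and upper
   triangular factors multiply, and invert, truncation by truncation. *)
Definition gauss_borel G S H Sh : Prop :=
  [/\ lower_unitriangular S, lower_unitriangular Sh, block_diagonal H,
      forall k, block H k k \in unitmx &
      forall k, trunc G k =
        invmx (trunc S k) *m trunc H k *m (invmx (trunc Sh k)) ^t*].

Definition gauss_borel_H G : smatrix C D :=
  xget (fun _ _ => 0) [set H | exists S Sh, gauss_borel G S H Sh].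

(* The shift by [e_b]; its inverse is its transpose. *)
Definition Upsilon (b : 'I_D) : smatrix C D :=
  fun beta gamma => (beta + delta_mx 0 b == gamma)%:R.

Definition Upsilon_inv (b : 'I_D) : smatrix C D :=
  fun beta gamma => Upsilon b gamma beta.

(* The entries of the vector are listed as
   [n_(-1), ..., n_(-D), n_D, ..., n_1]. *)
Definition ncoef_neg (n : 'cV[C]_(D + D)) (b : 'I_D) : C := n (lshift D b) 0.
Definition ncoef_pos (n : 'cV[C]_(D + D)) (b : 'I_D) : C :=
  n (rshift D (rev_ord b)) 0.

Definition spectral_nu (n : 'cV[C]_(D + D)) : smatrix C D :=
  fun beta gamma => \sum_(b < D)
    (ncoef_neg n b * Upsilon_inv b beta gamma
     + ncoef_pos n b * Upsilon b beta gamma).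

End SemiInfinite.

(** Moments and evolution *)

Section Moments.
Variables (R : realType) (D : nat).
Implicit Types (mu : complex_measure R D) (w : angles R D -> R[i]).

(* The moment matrix of the measure [w dmu]. *)
Definition moment_matrix mu w : smatrix R[i] D :=
  fun alpha beta => torus_integral mu (fun theta =>
    monomial alpha theta * (monomial beta theta)^* * w theta).

Definition quasi_definite mu w : Prop :=
  forall k, (1 <= k)%N -> \det (trunc (moment_matrix mu w) k) != 0.

Definition laurent (n : 'cV[R[i]]_(D + D)) (theta : angles R D) : R[i] :=
  \sum_(b < D) (ncoef_neg n b * (zcoord theta b)^-1
                + ncoef_pos n b * zcoord theta b).

Definition evolution (n : 'I_(D + D) -> 'cV[R[i]]_(D + D))
    (q : 'I_(D + D) -> R[i]) (m : 'I_(D + D) -> nat)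
    (theta : angles R D) : R[i] :=
  \prod_(a < D + D) (laurent (n a) theta - q a) ^+ m a.

Definition Hblock mu (n : 'I_(D + D) -> 'cV[R[i]]_(D + D))
    (q : 'I_(D + D) -> R[i]) (k : nat) (m : 'I_(D + D) -> nat) :
    'M[R[i]]_(size (shell D k)) :=
  block (gauss_borel_H (moment_matrix mu (evolution n q m))) k k.

End Moments.

(** Shifts and differences in the discrete times *)

Definition Tshift (I : eqType) (X : Type) (a : I) (f : (I -> nat) -> X)
    (m : I -> nat) : X :=
  f (fun c => (m c + (c == a))%N).

Definition Tdiff (I : eqType) (V : zmodType) (a : I) (f : (I -> nat) -> V)
    (m : I -> nat) : V :=
  Tshift a f m - f m.

(* Main.v *)
(** Write [A_a = nu_a - q_a].  Multiplying the measure by [L_{n_a}(z) - q_a]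
    multiplies the moment matrix by [A_a] on either side: [T_a G = A_a G = G A_a].
    With [G = L H U] (so that [L = S^-1] and [U] is the inverse of the adjoint of
    the other triangular factor) this gives
    [(T_a L)^-1 A_a L = (T_a H) (T_a U) U^-1 H^-1], which is therefore block upper
    bidiagonal, with explicit entries; likewise [L^-1 (T_b L)] is block lower
    bidiagonal.  The [(k, k)] block of
    [T_a (L^-1 T_b L) . T_b ((T_a L)^-1 A_a L) = (T_a L)^-1 A_a (T_b L)
      = ((T_a L)^-1 A_a L) . (L^-1 T_b L)]
    is the first Toda equation; the second is its transpose.  Everything is done on
    the truncations to [k + 2] blocks: the factors of [G] truncate exactly, and
    truncating [A_a G] or [G A_a] only spoils the last block row or column. *)

Require Import Defs.
From mathcomp Require Import all_boot all_order all_algebra complex.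
From mathcomp Require Import zify ring spectral sesquilinear.
From mathcomp Require Import all_classical all_reals all_analysis.
Import Order.TTheory GRing.Theory Num.Theory.
Import numFieldNormedType.Exports.
Local Open Scope ring_scope.

Set Implicit Arguments.
Unset Strict Implicit.
Unset Printing Implicit Defensive.

(** * Block triangular and block diagonal finite matrices *)

Section BlockMatrices.
Variables (F : fieldType) (N : nat) (p : 'I_N -> nat).
Local Notation bmx := 'M[F]_(\sum_(i < N) p i).
Implicit Types (A B G H L U X Y Z : bmx).

Definition block_lower_unitri L :=
  (forall i j : 'I_N, (i < j)%N -> submxblock L i j = 0) /\
  (forall i, submxblock L i i = 1%:M).

Definition block_upper_unitri U :=
  (forall i j : 'I_N, (j < i)%N -> submxblock U i j = 0) /\
  (forall i, submxblock U i i = 1%:M).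

Definition block_diag H :=
  (forall i j : 'I_N, i != j -> submxblock H i j = 0) /\
  (forall i, submxblock H i i \in unitmx).

Lemma submxblock_mul X Y i j :
  submxblock (X *m Y) i j = \sum_s submxblock X i s *m submxblock Y s j.
Proof. by rewrite -{1}[X]submxblockK -{1}[Y]submxblockK mul_mxblock mxblockK. Qed.

Lemma block_unitri_tr L : block_lower_unitri L <-> block_upper_unitri L^T.
Proof.
split=> -[h0 h1]; split=> [i j ij|i].
- by rewrite -tr_submxblock h0// trmx0.
- by rewrite -tr_submxblock h1 trmx1.
- by apply: trmx_inj; rewrite tr_submxblock h0// trmx0.
- by apply: trmx_inj; rewrite tr_submxblock h1 trmx1.
Qed.

Lemma block_unitri_trV U : block_upper_unitri U <-> block_lower_unitri U^T.
Proof. by have := block_unitri_tr U^T; rewrite trmxK => -[]; split. Qed.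

Lemma block_lower_unitri_unit L : block_lower_unitri L -> L \in unitmx.
Proof.
move=> [L0 L1]; have Ltrig : is_trig_mx L.
  rewrite -[L]submxblockK; apply/is_trig_mxblockP; split=> // i.
  by rewrite L1 scalar_mx_is_trig.
rewrite unitmxE det_trig// big1 ?unitr1// => i _.
rewrite -[L]submxblockK mxE.
by rewrite L1 mxE eqxx.
Qed.

Lemma submxblock1_neq i j : i != j -> submxblock (1%:M : bmx) i j = 0.
Proof.
move=> ij; apply/matrixP => s t.
by rewrite !mxE -val_eqE tagnat.eq_Rank (negPf ij).
Qed.

Lemma submxblock1 i : submxblock (1%:M : bmx) i i = 1%:M.
Proof.
by apply/matrixP => s t; rewrite !mxE -val_eqE tagnat.eq_Rank eqxx.
Qed.

(** Forward substitution: block row [i] of [L *m invmx L = 1] expresses row [i] of the inverse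
    through its rows [s < i], so strong induction on [i] carries the triangular shape over. *)
Lemma block_lower_unitri_inv L :
  block_lower_unitri L -> block_lower_unitri (invmx L).
Proof.
move=> Llow; have [L0 L1] := Llow; have Lu := block_lower_unitri_unit Llow.
have E i j : submxblock (invmx L) i j = submxblock (1%:M : bmx) i j -
    \sum_(s < N | (s < i)%N) submxblock L i s *m submxblock (invmx L) s j.
  apply/eqP; rewrite eq_sym subr_eq -(mulmxV Lu) submxblock_mul.
  rewrite (bigD1 i)//= L1 mul1mx; apply/eqP; congr (_ + _).
  rewrite big_mkcond [RHS]big_mkcond; apply: eq_bigr => s _.
  case: ltngtP => [||/val_inj ->]; rewrite ?eqxx//.
  - by move=> si; rewrite -val_eqE/= ltn_eqF.
  - by move=> si; rewrite L0// mul0mx if_same.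
have V0 (i j : 'I_N) : (i < j)%N -> submxblock (invmx L) i j = 0.
  have [n] := ubnP i; elim: n i => // n IH i ltin ij.
  rewrite E submxblock1_neq -?val_eqE/= ?ltn_eqF// big1 ?subr0// => s si.
  by rewrite IH ?mulmx0//; [exact: leq_trans si _|exact: ltn_trans ij].
split=> // i; rewrite E submxblock1 big1 ?subr0// => s si.
by rewrite V0// mulmx0.
Qed.

Lemma block_lower_unitri_mul L K : block_lower_unitri L ->
  block_lower_unitri K -> block_lower_unitri (L *m K).
Proof.
move=> [L0 L1] [K0 K1]; split=> [i j ij|i]; rewrite submxblock_mul.
  rewrite big1// => s _; case: (ltnP i s) => [/L0->|si]; rewrite ?mul0mx//.
  by rewrite K0 ?mulmx0//; exact: leq_ltn_trans ij.
rewrite (bigD1 i)//= L1 K1 mulmx1 [X in _ + X]big1 ?addr0// => s si.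
case: (ltngtP i s) => [/L0->|/K0->|/val_inj is']; rewrite ?mul0mx ?mulmx0//.
by rewrite is' eqxx in si.
Qed.

Lemma block_upper_unitri_unit U : block_upper_unitri U -> U \in unitmx.
Proof.
by move=> /block_unitri_trV/block_lower_unitri_unit; rewrite unitmx_tr.
Qed.

Lemma block_upper_unitri_inv U :
  block_upper_unitri U -> block_upper_unitri (invmx U).
Proof.
move=> /block_unitri_trV/block_lower_unitri_inv; rewrite -trmx_inv.
by move/block_unitri_trV.
Qed.

Lemma block_upper_unitri_mul U V : block_upper_unitri U ->
  block_upper_unitri V -> block_upper_unitri (U *m V).
Proof.
move=> /block_unitri_trV hU /block_unitri_trV hV; apply/block_unitri_trV.
by rewrite trmx_mul; exact: block_lower_unitri_mul.
Qed.

Lemma submxblock_mul_diagl H X i j : block_diag H ->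
  submxblock (H *m X) i j = submxblock H i i *m submxblock X i j.
Proof.
move=> [H0 _]; rewrite submxblock_mul (bigD1 i)//= big1 ?addr0// => s si.
by rewrite H0 ?mul0mx// eq_sym.
Qed.

Lemma submxblock_mul_diagr H X i j : block_diag H ->
  submxblock (X *m H) i j = submxblock X i j *m submxblock H j j.
Proof.
move=> [H0 _]; rewrite submxblock_mul (bigD1 j)//= big1 ?addr0// => s si.
by rewrite H0 ?mulmx0.
Qed.

(** The other blocks in row [i] of [H] vanish, so the [(i, i)] block of [H *m invmx H = 1] exhibits
    a right inverse. *)
Lemma submxblock_diag_unit H i :
  (forall i j : 'I_N, i != j -> submxblock H i j = 0) -> H \in unitmx ->
  submxblock H i i \in unitmx.
Proof.
move=> H0 Hu; have := congr1 (fun X => submxblock X i i) (mulmxV Hu).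
rewrite submxblock1 submxblock_mul (bigD1 i)//= [X in _ + X]big1.
  by rewrite addr0 => /mulmx1_unit[].
by move=> s si; rewrite H0 ?mul0mx// eq_sym.
Qed.

(** The upper factor stands for the inverse adjoint of the second triangular Gauss-Borel factor. In
    this form plain transposition exchanges the two triangular factors, with no conjugation
    involved. *)
Definition block_ldu G L H U :=
  [/\ block_lower_unitri L, block_diag H, block_upper_unitri U &
      G = L *m H *m U].

Lemma block_ldu_tr G L H U : block_ldu G L H U -> block_ldu G^T U^T H^T L^T.
Proof.
move=> [hL [H0 H1] hU ->]; split.
- exact/block_unitri_trV.
- split=> [i j ij|i]; rewrite -tr_submxblock; last by rewrite unitmx_tr.
  by rewrite H0 ?trmx0// eq_sym.
- exact/block_unitri_tr.
- by rewrite !trmx_mul mulmxA.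
Qed.

(** * Dressed spectral matrices and connection matrices *)

Section Lax.
Variables (G L H U G' L' H' U' A : bmx).
Hypotheses (ldu : block_ldu G L H U) (ldu' : block_ldu G' L' H' U').

Section Rows.
(* The truncation of an infinite product [A G] with [A] block tridiagonal agrees
   with the product of the truncations except in the last block row. *)
Hypothesis AG : forall i j : 'I_N, (i.+1 < N)%N ->
  submxblock (A *m G) i j = submxblock G' i j.
Hypothesis A_upper : forall i j : 'I_N, (i.+1 < j)%N -> submxblock A i j = 0.

Let W := invmx L' *m A *m L.

Let L'V0 (i j : 'I_N) : (i < j)%N -> submxblock (invmx L') i j = 0.
Proof. by case: ldu' => [/block_lower_unitri_inv[+ _] _ _ _]; exact. Qed.

Let L'A (i j : 'I_N) : submxblock (invmx L' *m A) i j =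
  \sum_(s < N | (s <= i)%N && (j <= s.+1)%N)
     submxblock (invmx L') i s *m submxblock A s j.
Proof.
rewrite submxblock_mul [RHS]big_mkcond; apply: eq_bigr => s _.
case: ifPn => //; rewrite negb_and -!ltnNge.
by case/orP => [/L'V0->|/A_upper->]; rewrite ?mul0mx ?mulmx0.
Qed.

Let L'A0 (i j : 'I_N) : (i.+1 < j)%N -> submxblock (invmx L' *m A) i j = 0.
Proof. by move=> ij; rewrite L'A big_pred0// => s; lia. Qed.

(** The outer factors [invmx L'] and [L] are block lower triangular, so [W] reaches no further above
    the diagonal than [A], which is one block. *)
Lemma dressed_row0 (i j : 'I_N) : (i.+1 < j)%N -> submxblock W i j = 0.
Proof.
move=> ij; case: ldu => [[L0 _] _ _ _].
rewrite /W submxblock_mul big1// => t _.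
case: (ltnP t j) => [/L0->|jt]; first by rewrite mulmx0.
by rewrite L'A0 ?mul0mx//; lia.
Qed.

(** To climb one block, the step up must be taken in [A], and the two triangular factors contribute
    only their identity diagonal blocks. *)
Lemma dressed_row_succ (i j : 'I_N) : i.+1 = j :> nat ->
  submxblock W i j = submxblock A i j.
Proof.
move=> ij; case: ldu => [[L0 L1] _ _ _]; case: ldu' => [+ _ _ _].
move=> /block_lower_unitri_inv[_ L'V1].
rewrite /W submxblock_mul (bigD1 j)//= L1 mulmx1 [X in _ + X]big1 ?addr0.
  rewrite L'A (big_pred1 i) ?L'V1 ?mul1mx// => s.
  by rewrite -ij ltnS -eqn_leq.
move=> t tj; case: (ltngtP t j) => [/L0->|jt|/val_inj tj'].
- by rewrite mulmx0.
- by rewrite L'A0 ?mul0mx//; lia.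
- by rewrite tj' eqxx in tj.
Qed.

(** Both sides are the [(i, j)] block of [invmx L' *m X *m invmx U], with [X] equal to [A *m G] or
    to [G']. Row [i] of [invmx L'] only meets rows [s <= i] of [X], so the spoilt last block row of
    [A *m G] does not enter. *)
Lemma dressed_row (i j : 'I_N) : (i.+1 < N)%N ->
  submxblock W i j *m submxblock H j j =
  submxblock H' i i *m submxblock (U' *m invmx U) i j.
Proof.
move=> iN; case: ldu => [hL hH hU GE]; case: ldu' => [hL' hH' hU' GE'].
rewrite -submxblock_mul_diagl// -submxblock_mul_diagr//.
have -> : W *m H = invmx L' *m (A *m G) *m invmx U.
  rewrite /W GE !mulmxA mulmxK//; exact: block_upper_unitri_unit.
have -> : H' *m (U' *m invmx U) = invmx L' *m G' *m invmx U.
  rewrite GE' -!mulmxA mulKmx//; exact: block_lower_unitri_unit.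
rewrite !submxblock_mul; apply: eq_bigr => t _; congr (_ *m _).
rewrite !submxblock_mul; apply: eq_bigr => s _.
case: (ltnP i s) => [/L'V0->|si]; first by rewrite !mul0mx.
by rewrite AG//; lia.
Qed.

(** The product [U' *m invmx U] is block unitriangular, so on the diagonal [dressed_row] involves
    only [H] and [H'] besides [W]. *)
Lemma dressed_row_diag (i : 'I_N) : (i.+1 < N)%N ->
  submxblock W i i = submxblock H' i i *m invmx (submxblock H i i).
Proof.
move=> iN; have := dressed_row i iN; case: ldu => [_ [_ Hu] hU _].
case: ldu' => [_ _ hU' _].
have [_ ->] := block_upper_unitri_mul hU' (block_upper_unitri_inv hU).
by rewrite mulmx1 => <-; rewrite mulmxK.
Qed.

End Rows.

Section Columns.
Hypothesis GA : forall i j : 'I_N, (j.+1 < N)%N ->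
  submxblock (G *m A) i j = submxblock G' i j.
Hypothesis A_lower : forall i j : 'I_N, (j.+1 < i)%N -> submxblock A i j = 0.

Let K := invmx L *m L'.

Lemma connection_unitri : block_lower_unitri K.
Proof.
case: ldu ldu' => [hL _ _ _] [hL' _ _ _].
by apply: block_lower_unitri_mul => //; exact: block_lower_unitri_inv.
Qed.

(** Mirror image of [dressed_row]: both sides are blocks of [invmx L *m X *m invmx U'], with [X]
    equal to [G'] or to [G *m A], and column [j] of [invmx U'] only meets columns [t <= j] of
    [X]. *)
Lemma connection_col (i j : 'I_N) : (j.+1 < N)%N ->
  submxblock K i j *m submxblock H' j j =
  submxblock H i i *m submxblock (U *m A *m invmx U') i j.
Proof.
move=> jN; case: ldu => [hL hH hU GE]; case: ldu' => [hL' hH' hU' GE'].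
rewrite -submxblock_mul_diagl// -submxblock_mul_diagr//.
have -> : K *m H' = invmx L *m (G' *m invmx U').
  rewrite GE' mulmxK ?mulmxA//; exact: block_upper_unitri_unit.
have -> : H *m (U *m A *m invmx U') = invmx L *m (G *m A *m invmx U').
  rewrite GE -!mulmxA mulKmx//; exact: block_lower_unitri_unit.
rewrite !submxblock_mul; apply: eq_bigr => s _; congr (_ *m _).
rewrite !submxblock_mul; apply: eq_bigr => t _.
have [U'V0 _] := block_upper_unitri_inv hU'.
case: (ltnP j t) => [/U'V0->|tj]; first by rewrite !mulmx0.
by rewrite GA//; lia.
Qed.

Let UA (i j : 'I_N) : submxblock (U *m A) i j =
  \sum_(s < N | (i <= s)%N && (s <= j.+1)%N)
     submxblock U i s *m submxblock A s j.
Proof.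
case: ldu => [_ _ [U0 _] _].
rewrite submxblock_mul [RHS]big_mkcond; apply: eq_bigr => s _.
case: ifPn => //; rewrite negb_and -!ltnNge.
by case/orP => [/U0->|/A_lower->]; rewrite ?mul0mx ?mulmx0.
Qed.

Let UA0 (i j : 'I_N) : (j.+1 < i)%N -> submxblock (U *m A) i j = 0.
Proof. by move=> ij; rewrite UA big_pred0// => s; lia. Qed.

(** By [connection_col] this block is governed by [U *m A *m invmx U']. One block below the diagonal
    the step down must be taken in [A], between identity blocks of the upper factors. *)
Lemma connection_succ (i j : 'I_N) : j.+1 = i :> nat ->
  submxblock K i j =
  submxblock H i i *m submxblock A i j *m invmx (submxblock H' j j).
Proof.
(* A block strictly below the diagonal never lies in the last block column. *)
move=> ij; have jN : (j.+1 < N)%N by rewrite ij.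
case: ldu ldu' => [_ _ [U0 U1] _] [_ [_ H'u] hU' _].
apply: (canRL (mulmxK (H'u j))); rewrite connection_col//; congr (_ *m _).
have [U'V0 U'V1] := block_upper_unitri_inv hU'.
rewrite submxblock_mul (bigD1 j)//= U'V1 mulmx1 [X in _ + X]big1 ?addr0.
  rewrite UA (big_pred1 i) ?U1 ?mul1mx// => s.
  by rewrite ij -eqn_leq eq_sym.
move=> t tj; case: (ltngtP j t) => [/U'V0->|jt|/val_inj tj'].
- by rewrite mulmx0.
- by rewrite UA0 ?mul0mx//; lia.
- by rewrite tj' eqxx in tj.
Qed.

(** The product [U *m A *m invmx U'] descends at most one block, and the invertible block [H'_jj]
    can be cancelled. *)
Lemma connection_far (i j : 'I_N) : (j.+1 < i)%N -> submxblock K i j = 0.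
Proof.
move=> ij; have jN : (j.+1 < N)%N by exact: leq_trans ij (ltnW (ltn_ord i)).
case: ldu ldu' => [_ _ [U0 U1] _] [_ [_ H'u] hU' _].
have [U'V0 _] := block_upper_unitri_inv hU'.
have := connection_col i jN; rewrite submxblock_mul big1 => [|t _].
  rewrite mulmx0 => /(congr1 (mulmx^~ (invmx (submxblock H' j j)))).
  by rewrite mulmxK ?mul0mx.
case: (ltnP j t) => [/U'V0->|tj]; first by rewrite mulmx0.
by rewrite UA0 ?mul0mx//; lia.
Qed.

End Columns.
End Lax.

(** * The Toda equation for truncated matrices *)

Section Toda.
Variables (G Ga Gb Gab L La Lb Lab H Ha Hb Hab U Ua Ub Uab A B : bmx).
Hypotheses (ldu : block_ldu G L H U) (ldua : block_ldu Ga La Ha Ua).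
Hypotheses (ldub : block_ldu Gb Lb Hb Ub) (lduab : block_ldu Gab Lab Hab Uab).
Hypothesis AG : forall i j : 'I_N, (i.+1 < N)%N ->
  submxblock (A *m G) i j = submxblock Ga i j.
Hypothesis AGb : forall i j : 'I_N, (i.+1 < N)%N ->
  submxblock (A *m Gb) i j = submxblock Gab i j.
Hypothesis GB : forall i j : 'I_N, (j.+1 < N)%N ->
  submxblock (G *m B) i j = submxblock Gb i j.
Hypothesis GaB : forall i j : 'I_N, (j.+1 < N)%N ->
  submxblock (Ga *m B) i j = submxblock Gab i j.
Hypothesis A_upper : forall i j : 'I_N, (i.+1 < j)%N -> submxblock A i j = 0.
Hypothesis B_lower : forall i j : 'I_N, (j.+1 < i)%N -> submxblock B i j = 0.

(* Both sides are the diagonal block of [La^-1 A Lb], factored as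
   [(La^-1 Lab)(Lab^-1 A Lb)] and as [(La^-1 A L)(L^-1 Lb)]. *)
Lemma block_toda (k : 'I_N) : (k.+1 < N)%N ->
  submxblock Hab k k *m invmx (submxblock Hb k k) +
    \sum_(s < N | s.+1 == k :> nat)
      submxblock Ha k k *m submxblock B k s *m invmx (submxblock Hab s s)
        *m submxblock A s k =
  submxblock Ha k k *m invmx (submxblock H k k) +
    \sum_(s < N | k.+1 == s :> nat)
      submxblock A k s *m submxblock H s s *m submxblock B s k
        *m invmx (submxblock Hb k k).
Proof.
move=> kN.
have LabU : Lab \in unitmx.
  by case: lduab => [/block_lower_unitri_unit].
have LU : L \in unitmx by case: ldu => [/block_lower_unitri_unit].
have E : (invmx La *m Lab) *m (invmx Lab *m A *m Lb) =
         (invmx La *m A *m L) *m (invmx L *m Lb).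
  by rewrite !mulmxA mulmxK// -!mulmxA mulKVmx.
have {E} := congr1 (fun X => submxblock X k k) E; rewrite !submxblock_mul.
(* In the split-off terms [s = k] the connection matrix contributes an identity and the dressed
   matrix a quotient of diagonal blocks. *)
rewrite (bigD1 k)//= [in X in _ = X -> _](bigD1 k)//=.
have [KA0 KA1] := connection_unitri ldua lduab.
have [K0 K1] := connection_unitri ldu ldub.
rewrite KA1 K1 mul1mx mulmx1 (dressed_row_diag ldub lduab AGb)//.
rewrite (dressed_row_diag ldu ldua AG)// => E.
(* The connection matrix is lower bidiagonal, so only [s = k - 1] remains; for [k = 0] the sum is
   empty. *)
have EA : \sum_(s < N | s != k) submxblock (invmx La *m Lab) k s *m
      submxblock (invmx Lab *m A *m Lb) s k =
    \sum_(s < N | s.+1 == k :> nat) submxblock Ha k k *m submxblock B k s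
      *m invmx (submxblock Hab s s) *m submxblock A s k.
  rewrite big_mkcond [RHS]big_mkcond; apply: eq_bigr => s _.
  case: (ltngtP s k) => sk; last 2 first.
  - rewrite KA0// mul0mx if_same; case: eqP => //; lia.
  - by rewrite (val_inj sk) eqxx; case: eqP => //; lia.
  rewrite -val_eqE ltn_eqF//=; case: eqP => [sk1|/eqP sk1].
    rewrite (connection_succ ldua lduab GaB)// (dressed_row_succ ldub lduab)//.
  by rewrite (connection_far ldua lduab GaB B_lower) ?mul0mx//; lia.
(* The connection matrix vanishes for [s < k] and the dressed matrix for [s > k + 1], which leaves
   [s = k + 1]. *)
have EB : \sum_(s < N | s != k) submxblock (invmx La *m A *m L) k s *m
      submxblock (invmx L *m Lb) s k =
    \sum_(s < N | k.+1 == s :> nat) submxblock A k s *m submxblock H s s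
      *m submxblock B s k *m invmx (submxblock Hb k k).
  rewrite big_mkcond [RHS]big_mkcond; apply: eq_bigr => s _.
  case: (ltngtP s k) => sk.
  - by rewrite K0// mulmx0 if_same; case: eqP => //; lia.
  - rewrite -val_eqE gtn_eqF//=; case: eqP => [ks|/eqP ks].
      rewrite (dressed_row_succ ldu ldua)// (connection_succ ldu ldub GB)//.
      by rewrite !mulmxA.
    by rewrite (dressed_row0 ldu ldua A_upper) ?mul0mx//; lia.
  - by rewrite (val_inj sk) eqxx; case: eqP => //; lia.
by rewrite EA EB in E.
Qed.
End Toda.

(** This is [block_toda] for the transposed data. Transposition reverses products, so [A] now
    multiplies from the right and [B] from the left. *)
Lemma block_toda_tr G Ga Gb Gab L La Lb Lab H Ha Hb Hab U Ua Ub Uab A B :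
    block_ldu G L H U -> block_ldu Ga La Ha Ua ->
    block_ldu Gb Lb Hb Ub -> block_ldu Gab Lab Hab Uab ->
    (forall i j : 'I_N, (j.+1 < N)%N ->
      submxblock (G *m A) i j = submxblock Ga i j) ->
    (forall i j : 'I_N, (j.+1 < N)%N ->
      submxblock (Gb *m A) i j = submxblock Gab i j) ->
    (forall i j : 'I_N, (i.+1 < N)%N ->
      submxblock (B *m G) i j = submxblock Gb i j) ->
    (forall i j : 'I_N, (i.+1 < N)%N ->
      submxblock (B *m Ga) i j = submxblock Gab i j) ->
    (forall i j : 'I_N, (j.+1 < i)%N -> submxblock A i j = 0) ->
    (forall i j : 'I_N, (i.+1 < j)%N -> submxblock B i j = 0) ->
  forall k : 'I_N, (k.+1 < N)%N ->
  invmx (submxblock Hb k k) *m submxblock Hab k k +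
    \sum_(s < N | s.+1 == k :> nat)
      submxblock A k s *m invmx (submxblock Hab s s) *m submxblock B s k
        *m submxblock Ha k k =
  invmx (submxblock H k k) *m submxblock Ha k k +
    \sum_(s < N | k.+1 == s :> nat)
      invmx (submxblock Hb k k) *m submxblock B k s *m submxblock H s s
        *m submxblock A s k.
Proof.
move=> ldu ldua ldub lduab GA GbA BG BGa A0 B0 k kN; apply: trmx_inj.
rewrite !linearD/=; apply: (etrans _ (etrans (block_toda (A := A^T) (B := B^T)
  (block_ldu_tr ldu) (block_ldu_tr ldua) (block_ldu_tr ldub)
  (block_ldu_tr lduab) _ _ _ _ _ _ kN) _)) =>
  [|i j ij|i j ij|i j ij|i j ij|i j ij|i j ij|];
  rewrite -?trmx_mul -?tr_submxblock.
- congr (_ + _); first by rewrite trmx_mul trmx_inv.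
  rewrite raddf_sum/=; apply: eq_bigr => s _.
  by rewrite !trmx_mul trmx_inv !tr_submxblock !mulmxA.
- by rewrite GA.
- by rewrite GbA.
- by rewrite BG.
- by rewrite BGa.
- by rewrite A0 ?trmx0.
- by rewrite B0 ?trmx0.
- symmetry; congr (_ + _); first by rewrite trmx_mul trmx_inv.
  rewrite raddf_sum/=; apply: eq_bigr => s _.
  by rewrite !trmx_mul trmx_inv !tr_submxblock !mulmxA.
Qed.
End BlockMatrices.

(** * Existence of the Gauss-Borel factorization *)

Section GaussBorel.
Local Open Scope sesquilinear_scope.
Variables (C : numClosedFieldType) (D : nat).
Local Notation d k := (size (shell D k)).
Implicit Types G S H A : smatrix C D.

Lemma mnorm_nth k (t : 'I_(d k)) : mnorm (nth 0 (shell D k) t) = k.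
Proof. by apply/eqP; rewrite -mem_shell mem_nth. Qed.

Lemma index_shell (alpha : 'rV[int]_D) :
  (index alpha (shell D (mnorm alpha)) < d (mnorm alpha))%N.
Proof. by rewrite index_mem mem_shell. Qed.

(** A section of [block]: a multi-index is located by its norm and its position in its shell. *)
Definition of_blocks (X : forall k l, 'M[C]_(d k, d l)) : smatrix C D :=
  fun alpha beta => X (mnorm alpha) (mnorm beta)
    (Ordinal (index_shell alpha)) (Ordinal (index_shell beta)).

Lemma block_of_blocks X k l : block (of_blocks X) k l = X k l.
Proof.
(* General [alpha] and [beta] allow the norm equations to be substituted in the dependent type of
   [X]. *)
have of_blocksE alpha beta (i : 'I_(d k)) (j : 'I_(d l)) :
    mnorm alpha = k -> mnorm beta = l ->
    index alpha (shell D k) = i -> index beta (shell D l) = j ->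
    of_blocks X alpha beta = X k l i j.
  move=> hk hl; subst k l => hi hj; rewrite /of_blocks.
  by congr (X _ _ _ _); exact: val_inj.
by apply/matrixP => i j; rewrite mxE; apply: of_blocksE;
  rewrite ?mnorm_nth ?index_uniq ?shell_uniq.
Qed.

Lemma submxblock_trunc A N (i j : 'I_N) : submxblock (trunc A N) i j = block A i j.
Proof. exact: mxblockK. Qed.

Definition sadjoint G : smatrix C D := fun alpha beta => (G beta alpha)^*.

Lemma trunc_sadjoint G k : trunc (sadjoint G) k = (trunc G k)^t*.
Proof. by apply/matrixP => i j; rewrite !mxE. Qed.

(** Quasi-definiteness speaks of [k >= 1] only; the empty truncation is covered here. *)
Lemma trunc0_unit G : trunc G 0 \in unitmx.
Proof.
rewrite (_ : trunc G 0 = 1%:M) ?unitmx1//.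
apply/matrixP => i; suff: (i < 0)%N by [].
by case: i => i /=; rewrite big_ord0.
Qed.

(** [Y] is to be block row [k] of [S]. For a moment matrix it holds the coefficients of the monic
    Laurent polynomials of degree [k] orthogonal to all monomials of smaller norm, found from a
    linear system with matrix [trunc G k]. *)
Lemma orthogonal_row G k : trunc G k \in unitmx ->
  {Y : forall l, 'M[C]_(d k, d l) |
    [/\ forall l, (k < l)%N -> Y l = 0, Y k = 1%:M &
        forall l, (l < k)%N -> \sum_(i < k.+1) Y i *m block G i l = 0]}.
Proof.
move=> Gu.
(* The blocks of [R] are the coefficients below degree [k]; those above vanish. *)
pose R := (- (\mxrow_(j < k) block G k j)) *m invmx (trunc G k).
have [Y hY] : {Y : forall l, 'M[C]_(d k, d l) |
    forall l, [/\ (k < l)%N -> Y l = 0,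
      k = l -> Y l = conform_mx 0 (1%:M : 'M[C]_(d k)) &
     forall h : (l < k)%N, Y l = submxrow R (Ordinal h)]}.
  (* The size of [Y l] depends on [l], so at [l = k] the identity is inserted through [conform_mx]
     instead of a cast. *)
  have Y l : {M : 'M[C]_(d k, d l) |
     [/\ (k < l)%N -> M = 0, k = l -> M = conform_mx 0 (1%:M : 'M[C]_(d k)) &
         forall h : (l < k)%N, M = submxrow R (Ordinal h)]}.
    have [[h|h]|h] : ((l < k)%N + (k < l)%N + (l = k))%type.
      by case: (ltngtP l k) => h; [left; left|left; right|right].
    - exists (submxrow R (Ordinal h)); split=> [h'|h'|h']; try (exfalso; lia).
      by rewrite (bool_irrelevance h' h).
    - by exists 0; split=> // h'; exfalso; lia.
    - by exists (conform_mx 0 (1%:M : 'M[C]_(d k))); split=> // h'; exfalso; lia.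
  by exists (fun l => sval (Y l)) => l; exact: (svalP (Y l)).
exists Y; split=> [l| |l lk].
- by have [] := hY l.
- by have [_ -> // _] := hY k; rewrite conform_mx_id.
have := congr1 (fun M => submxrow M (Ordinal lk))
  (mulmxKV Gu (- (\mxrow_(j < k) block G k j))).
rewrite -/R -{1}[R]submxrowK mul_mxrow_mxblock mxrowK -mxrowN mxrowK => E.
rewrite big_ord_recr/= (_ : Y k = 1%:M); last first.
  by have [_ -> // _] := hY k; rewrite conform_mx_id.
rewrite mul1mx -[X in _ + X]opprK -E; apply/eqP; rewrite subr_eq0; apply/eqP.
apply: eq_bigr => -[i ik] _ /=; congr (_ *m _).
by have [_ _ /(_ ik)] := hY i.
Qed.

Lemma trunc_lower_unitri (L : smatrix C D) N :
  lower_unitriangular L -> block_lower_unitri (trunc L N).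
Proof.
by move=> [L0 L1]; split=> [i j ij|i]; rewrite submxblock_trunc ?L1// L0.
Qed.

(** Row [i] of the lower triangular factor stops at block [i], so the result does not depend on
    [N]. *)
Lemma mul_trunc_lower (L : smatrix C D) A N (i j : 'I_N) :
  lower_unitriangular L -> submxblock (trunc L N *m trunc A N) i j =
    \sum_(s < i.+1) block L i s *m block A s j.
Proof.
move=> [L0 _]; rewrite submxblock_mul.
rewrite (big_ord_widen N (fun s => block L i s *m block A s j) (ltn_ord i)).
rewrite big_mkcond/= [RHS]big_mkcond/=; apply: eq_bigr => s _.
rewrite !submxblock_trunc; case: ltnP => // si.
by rewrite L0 ?mul0mx.
Qed.

Lemma submxblock_adj N (p : 'I_N -> nat) (M : 'M[C]_(\sum_(i < N) p i)) i j :
  submxblock (M^t*) i j = (submxblock M j i)^t*.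
Proof. by apply/matrixP => s t; rewrite !mxE. Qed.

Lemma block_lower_unitri_adj N (p : 'I_N -> nat)
    (L : 'M[C]_(\sum_(i < N) p i)) :
  block_lower_unitri L -> block_upper_unitri (L^t*).
Proof.
move=> [L0 L1]; split=> [i j ij|i]; rewrite submxblock_adj ?L1 ?L0//.
  by rewrite trmx0 map_mx0.
by rewrite trmx1 map_mx1.
Qed.

Lemma invmx_adj n (M : 'M[C]_n) : (invmx M)^t* = invmx (M^t*).
Proof. by rewrite trmx_inv map_invmx. Qed.

Lemma unitmx_adj n (M : 'M[C]_n) : (M^t* \in unitmx) = (M \in unitmx).
Proof. by rewrite map_unitmx unitmx_tr. Qed.

Lemma orthogonal_rows G : (forall k, trunc G k \in unitmx) ->
  exists S : smatrix C D, lower_unitriangular S /\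
    forall k l, (l < k)%N ->
      \sum_(i < k.+1) block S k i *m block G i l = 0.
Proof.
move=> Gu; pose Y k := sval (orthogonal_row (Gu k)).
have hY k := svalP (orthogonal_row (Gu k)); rewrite -/(Y _) in hY.
exists (of_blocks Y); split; [split=> [k l|k]|move=> k l lk];
  have [Y0 Y1 YG] := hY k; rewrite ?block_of_blocks//; first exact: Y0.
by rewrite -[RHS](YG l lk); apply: eq_bigr => i _; rewrite block_of_blocks.
Qed.

(** Orthogonal rows for [G] make [S G] block upper triangular, and those for the adjoint of [G] make
    [G Sh^dagger] block lower triangular. Hence [S G Sh^dagger] is both, that is, block diagonal. *)
Lemma gauss_borel_exists G : (forall k, trunc G k \in unitmx) ->
  exists H S Sh, gauss_borel G S H Sh.
Proof.
move=> Gu; have [S [Slow SG]] := orthogonal_rows Gu.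
have [|Sh [Shlow ShG]] := @orthogonal_rows (sadjoint G).
  by move=> k; rewrite trunc_sadjoint unitmx_adj.
(* These are the diagonal blocks of [S G]; the block upper unitriangular factor [Sh^dagger] leaves
   them unchanged. *)
pose H := of_blocks (fun k l =>
  if k == l then \sum_(i < k.+1) block S k i *m block G i l else 0).
have HE k l : block H k l =
    if k == l then \sum_(i < k.+1) block S k i *m block G i l else 0.
  exact: block_of_blocks.
have SGE N (i j : 'I_N) := mul_trunc_lower G i j Slow.
have GShE N (i j : 'I_N) : (i < j)%N ->
    submxblock (trunc G N *m (trunc Sh N)^t*) i j = 0.
  move=> ij; have -> : trunc G N *m (trunc Sh N)^t* =
      (trunc Sh N *m trunc (sadjoint G) N)^t*.
    rewrite trmx_mul map_mxM trunc_sadjoint; congr (_ *m _).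
    by apply/matrixP => s t; rewrite !mxE; exact/esym/conjCK.
  rewrite submxblock_adj mul_trunc_lower// ShG// trmx0 map_mx0//.
have HN N : trunc S N *m trunc G N *m (trunc Sh N)^t* = trunc H N.
  have [S0 S1] := trunc_lower_unitri N Slow.
  have [Sh0 Sh1] := block_lower_unitri_adj (trunc_lower_unitri N Shlow).
  rewrite -[LHS]submxblockK -[RHS]submxblockK.
  apply/eq_mxblockP => i j; rewrite submxblock_trunc HE.
  case: (ltngtP i j) => ij.
  - rewrite -mulmxA submxblock_mul big1// => s _.
    case: (ltnP i s) => [/S0->|si]; first by rewrite mul0mx.
    by rewrite GShE ?mulmx0//; exact: leq_ltn_trans ij.
  - rewrite submxblock_mul big1// => s _.
    case: (ltnP j s) => [/Sh0->|sj]; first by rewrite mulmx0.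
    by rewrite SGE SG ?mul0mx//; exact: leq_ltn_trans ij.
  - have {ij} ij := val_inj ij; subst j.
    rewrite submxblock_mul (bigD1 i)//= Sh1 mulmx1 SGE [X in _ + X]big1 ?addr0//.
    move=> s si; case: (ltngtP i s) => [/Sh0->|si'|/val_inj si'].
    + by rewrite mulmx0.
    + by rewrite SGE SG ?mul0mx.
    + by rewrite si' eqxx in si.
have Su N : trunc S N \in unitmx.
  exact/block_lower_unitri_unit/trunc_lower_unitri.
have Shu N : trunc Sh N \in unitmx.
  exact/block_lower_unitri_unit/trunc_lower_unitri.
have Hdiag : block_diagonal H by move=> k l kl; rewrite HE (negPf kl).
exists H, S, Sh; split=> // k.
  (* The last diagonal block of this truncation is [block H k k]. *)
  have Hu : trunc H k.+1 \in unitmx.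
    by rewrite -HN !unitmx_mul Su Gu unitmx_adj Shu.
  rewrite -(submxblock_trunc H (@ord_max k) ord_max).
  apply: submxblock_diag_unit => // i j ij.
  by rewrite submxblock_trunc Hdiag// val_eqE.
by rewrite -HN invmx_adj -!mulmxA mulmxV ?unitmx_adj// mulmx1 mulKmx.
Qed.

Lemma gauss_borel_ldu G S H Sh N : gauss_borel G S H Sh ->
  block_ldu (trunc G N) (invmx (trunc S N)) (trunc H N)
    ((invmx (trunc Sh N))^t*).
Proof.
move=> [Slow Shlow Hdiag Hu GE]; split=> //.
- exact/block_lower_unitri_inv/trunc_lower_unitri.
- by split=> [i j ij|i]; rewrite submxblock_trunc ?Hu// Hdiag.
- by apply: block_lower_unitri_adj; exact/block_lower_unitri_inv/trunc_lower_unitri.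
Qed.
End GaussBorel.

(** * Spectral matrices acting on truncated moment matrices *)

Section Spectral.
Variables (C : numClosedFieldType) (D : nat).
Local Notation d k := (size (shell D k)).
Local Notation idx := 'rV[int]_D.
Local Notation e b := (delta_mx 0 b : idx).
Implicit Types (G A : smatrix C D) (n : 'cV[C]_(D + D)) (q : C).

Definition shells N : seq idx := flatten [seq shell D s | s <- index_iota 0 N].

Lemma sum_shells (V : nmodType) N (f : idx -> V) :
  \sum_(gamma <- shells N) f gamma =
  \sum_(s < N) \sum_(t < d s) f (nth 0 (shell D s) t).
Proof.
rewrite big_flatten big_map big_mkord; apply: eq_bigr => s _.
by rewrite (big_nth 0) big_mkord.
Qed.

(** The bound places [gamma0] among the summation indices. It is the origin of the exclusion of the
    last block row or column in products with truncated spectral matrices. *)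
Lemma sum_shells_pred1 N (f : idx -> C) gamma0 : (mnorm gamma0 < N)%N ->
  \sum_(gamma <- shells N) (gamma0 == gamma)%:R * f gamma = f gamma0.
Proof.
move=> lt0; rewrite big_flatten big_map big_mkord.
rewrite (bigD1 (Ordinal lt0))//= [X in _ + X]big1 ?addr0.
  rewrite (bigD1_seq gamma0) ?mem_shell ?shell_uniq//= eqxx mul1r.
  by rewrite big1 ?addr0// => gamma; rewrite eq_sym => /negPf ->; rewrite mul0r.
move=> s; rewrite -val_eqE/= => ss; rewrite big_seq big1// => gamma.
rewrite mem_shell => /eqP hg; case: eqP => [g0|_]; last by rewrite mul0r.
by rewrite g0 hg eqxx in ss.
Qed.

Lemma mnorm_addd alpha (b : 'I_D) : (mnorm (alpha + e b) <= (mnorm alpha).+1)%N.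
Proof.
rewrite /mnorm (bigD1 b)//= [X in (_ <= X.+1)%N](bigD1 b)//= !mxE !eqxx/=.
rewrite (eq_bigr (fun a => `|alpha 0%R a|%N)) => [|a ab].
  by rewrite -addSn leq_add2r; lia.
by rewrite !mxE (negPf ab) addr0.
Qed.

Lemma mnorm_subd alpha (b : 'I_D) : (mnorm (alpha - e b) <= (mnorm alpha).+1)%N.
Proof.
rewrite /mnorm (bigD1 b)//= [X in (_ <= X.+1)%N](bigD1 b)//= !mxE !eqxx/=.
rewrite (eq_bigr (fun a => `|alpha 0%R a|%N)) => [|a ab].
  by rewrite -addSn leq_add2r; lia.
by rewrite !mxE (negPf ab) subr0.
Qed.

Definition spectral_sub n q : smatrix C D :=
  fun beta gamma => spectral_nu n beta gamma - q * (beta == gamma)%:R.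

Lemma UpsilonE (b : 'I_D) alpha gamma :
  Upsilon C b alpha gamma = (alpha + e b == gamma)%:R.
Proof. by []. Qed.

Lemma Upsilon_invE (b : 'I_D) alpha gamma :
  Upsilon_inv C b alpha gamma = (alpha - e b == gamma)%:R.
Proof. by rewrite /Upsilon_inv /Upsilon subr_eq eq_sym. Qed.

(** A shift by [e b] in either direction raises the norm by at most one, so only equal or
    neighbouring shells are coupled. *)
Lemma block_spectral_sub0 n q k l : (k.+1 < l)%N || (l.+1 < k)%N ->
  block (spectral_sub n q) k l = 0.
Proof.
move=> kl; apply/matrixP => i j; rewrite !mxE /spectral_sub /spectral_nu.
set al := nth _ _ i; set be := nth _ _ j.
have mal : mnorm al = k by exact: mnorm_nth.
have mbe : mnorm be = l by exact: mnorm_nth.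
have near (b : 'I_D) (u v : idx) : u + e b = v ->
    (mnorm u <= (mnorm v).+1)%N && (mnorm v <= (mnorm u).+1)%N.
  move=> <-; rewrite mnorm_addd andbT -{1}[u](addrK (e b)); exact: mnorm_subd.
rewrite big1 => [|b _]; last first.
  rewrite Upsilon_invE UpsilonE subr_eq eq_sym.
  case: eqP => [/near|_]; first by rewrite mal mbe => ?; exfalso; lia.
  case: eqP => [/near|_]; first by rewrite mal mbe => ?; exfalso; lia.
  by rewrite !mulr0 addr0.
case: eqP => [ab|_]; last by rewrite mulr0 subr0.
by move: mal; rewrite ab mbe => ?; exfalso; lia.
Qed.

(** The constant [q] sits on the diagonal, which is why it disappears from the Toda equations. *)
Lemma block_spectral_sub_neq n q k l : k != l ->
  block (spectral_sub n q) k l = block (spectral_nu n) k l.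
Proof.
move=> kl; apply/matrixP => i j; rewrite !mxE /spectral_sub.
case: eqP => [ab|_]; last by rewrite mulr0 subr0.
by have := mnorm_nth i; rewrite ab mnorm_nth => lk; rewrite lk eqxx in kl.
Qed.

(** Both neighbours of [alpha] in each direction have norm below [N], so truncation loses no term of
    row [alpha]. *)
Lemma spectral_sub_mull N n q G alpha beta : ((mnorm alpha).+1 < N)%N ->
  \sum_(gamma <- shells N) spectral_sub n q alpha gamma * G gamma beta =
  \sum_(b < D) (ncoef_neg n b * G (alpha - e b) beta
                + ncoef_pos n b * G (alpha + e b) beta) - q * G alpha beta.
Proof.
move=> aN; rewrite /spectral_sub /spectral_nu.
under eq_bigr do rewrite mulrBl mulr_suml -mulrA.
rewrite sumrB exchange_big/= -mulr_sumr sum_shells_pred1; last exact: ltnW.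
congr (_ - _); apply: eq_bigr => b _.
under eq_bigr do rewrite mulrDl -!mulrA Upsilon_invE UpsilonE.
rewrite big_split/= -!mulr_sumr !sum_shells_pred1//.
- exact: leq_ltn_trans (mnorm_addd _ _) _.
- exact: leq_ltn_trans (mnorm_subd _ _) _.
Qed.

Lemma spectral_sub_mulr N n q G alpha beta : ((mnorm beta).+1 < N)%N ->
  \sum_(gamma <- shells N) G alpha gamma * spectral_sub n q gamma beta =
  \sum_(b < D) (ncoef_neg n b * G alpha (beta + e b)
                + ncoef_pos n b * G alpha (beta - e b)) - q * G alpha beta.
Proof.
move=> aN; rewrite /spectral_sub /spectral_nu.
under eq_bigr do rewrite mulrC mulrBl mulr_suml -mulrA [_ == beta]eq_sym.
rewrite sumrB exchange_big/= -mulr_sumr (sum_shells_pred1 (G alpha)); last exact: ltnW.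
congr (_ - _); apply: eq_bigr => b _.
under eq_bigr=> gamma _.
  rewrite mulrDl -!mulrA [Upsilon_inv _ _ _ _]UpsilonE.
  rewrite -[Upsilon _ _ _ _]/(Upsilon_inv C b beta gamma) Upsilon_invE.
  over.
rewrite big_split/= -!mulr_sumr !(sum_shells_pred1 (G alpha))//.
- exact: leq_ltn_trans (mnorm_subd _ _) _.
- exact: leq_ltn_trans (mnorm_addd _ _) _.
Qed.

(* The two expressions for the moments of [(L_n - q) dmu]:
   [G' = (nu - q) G] and [G' = G (nu - q)], entry by entry. *)
Definition darboux n q G G' :=
  (forall alpha beta, G' alpha beta =
    \sum_(b < D) (ncoef_neg n b * G (alpha - e b) beta
                  + ncoef_pos n b * G (alpha + e b) beta) - q * G alpha beta) /\
  (forall alpha beta, G' alpha beta =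
    \sum_(b < D) (ncoef_neg n b * G alpha (beta + e b)
                  + ncoef_pos n b * G alpha (beta - e b)) - q * G alpha beta).

Lemma submxblock_trunc_mul A G N (i j : 'I_N) s t :
  submxblock (trunc A N *m trunc G N) i j s t =
  \sum_(gamma <- shells N) A (nth 0 (shell D i) s) gamma *
                           G gamma (nth 0 (shell D j) t).
Proof.
rewrite submxblock_mul summxE sum_shells; apply: eq_bigr => r _.
by rewrite mxE; apply: eq_bigr => u _; rewrite !submxblock_trunc !mxE.
Qed.

Lemma darboux_mull n q G G' N (i j : 'I_N) : darboux n q G G' ->
  (i.+1 < N)%N ->
  submxblock (trunc (spectral_sub n q) N *m trunc G N) i j =
  submxblock (trunc G' N) i j.
Proof.
move=> [GE _] iN; apply/matrixP => s t.
by rewrite submxblock_trunc_mul spectral_sub_mull ?mnorm_nth// submxblock_trunc mxE GE.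
Qed.

Lemma darboux_mulr n q G G' N (i j : 'I_N) : darboux n q G G' ->
  (j.+1 < N)%N ->
  submxblock (trunc G N *m trunc (spectral_sub n q) N) i j =
  submxblock (trunc G' N) i j.
Proof.
move=> [_ GE] iN; apply/matrixP => s t.
by rewrite submxblock_trunc_mul spectral_sub_mulr ?mnorm_nth// submxblock_trunc mxE GE.
Qed.

(** Turns the conditional sum of the truncated equations into the case distinction that drops the
    block index [-1]. *)
Lemma sum_ord_succ_eq (V : nmodType) k (F : nat -> V) :
  \sum_(s < k.+2 | s.+1 == k) F s = if k is j.+1 then F j else 0.
Proof.
case: k => [|j]; first by rewrite big_pred0.
by rewrite (big_pred1 (Ordinal (leqW (leqW (ltnSn j))))).
Qed.

Section Toda.
Variables (na nb : 'cV[C]_(D + D)) (qa qb : C).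
Variables (G Ga Gb Gab H Ha Hb Hab S Sa Sb Sab Sh Sha Shb Shab : smatrix C D).
Hypotheses (gb : gauss_borel G S H Sh) (gba : gauss_borel Ga Sa Ha Sha).
Hypotheses (gbb : gauss_borel Gb Sb Hb Shb) (gbab : gauss_borel Gab Sab Hab Shab).
Hypotheses (da : darboux na qa G Ga) (dab : darboux na qa Gb Gab).
Hypotheses (db : darboux nb qb G Gb) (dba : darboux nb qb Ga Gab).
Local Notation nu c := (spectral_nu c).

Lemma smatrix_toda_left k :
  block Hab k k *m invmx (block Hb k k) - block Ha k k *m invmx (block H k k) =
  block (nu na) k k.+1 *m block H k.+1 k.+1 *m block (nu nb) k.+1 k
    *m invmx (block Hb k k)
  - match k return 'M[C]_(d k) with
    | 0 => 0
    | j.+1 => block Ha j.+1 j.+1 *m block (nu nb) j.+1 j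
                *m invmx (block Hab j j) *m block (nu na) j j.+1
    end.
Proof.
(* With [k + 2] blocks the index [k + 1] is available and [k] is not the last one, as the truncated
   equation requires. *)
pose N := k.+2; have kN : (k < N)%N by []; have k1N : (k.+1 < N)%N by [].
have spectral0 n q (i j : 'I_N) : (i.+1 < j)%N || (j.+1 < i)%N ->
    submxblock (trunc (spectral_sub n q) N) i j = 0.
  by move=> ij; rewrite submxblock_trunc block_spectral_sub0.
have A0 (i j : 'I_N) : (i.+1 < j)%N ->
    submxblock (trunc (spectral_sub na qa) N) i j = 0.
  by move=> ij; rewrite spectral0 ?ij.
have B0 (i j : 'I_N) : (j.+1 < i)%N ->
    submxblock (trunc (spectral_sub nb qb) N) i j = 0.
  by move=> ij; rewrite spectral0 ?ij ?orbT.
have := block_toda (gauss_borel_ldu N gb) (gauss_borel_ldu N gba)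
  (gauss_borel_ldu N gbb) (gauss_borel_ldu N gbab)
  (fun i j => darboux_mull j da) (fun i j => darboux_mull j dab)
  (fun i j => darboux_mulr i db) (fun i j => darboux_mulr i dba)
  A0 B0 (k := Ordinal kN) k1N.
rewrite !submxblock_trunc/=.
rewrite [in X in _ = X -> _](big_pred1 (Ordinal k1N)); last first.
  by move=> s; rewrite /= eq_sym -val_eqE.
rewrite !submxblock_trunc/= !block_spectral_sub_neq ?neq_ltn ?ltnSn ?orbT//.
under eq_bigr => s /eqP sk.
  have [ks sk'] : k != s /\ s != k :> nat by lia.
  rewrite !submxblock_trunc/= !block_spectral_sub_neq//; over.
rewrite (sum_ord_succ_eq k (fun s => block Ha k k *m block (nu nb) k s
  *m invmx (block Hab s s) *m block (nu na) s k)).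
move=> /(canRL (addrK _)) ->; rewrite addrAC [X in X - _]addrC addKr.
by case: (k).
Qed.
Lemma smatrix_toda_right k :
  invmx (block Hb k k) *m block Hab k k - invmx (block H k k) *m block Ha k k =
  invmx (block Hb k k) *m block (nu nb) k k.+1 *m block H k.+1 k.+1
    *m block (nu na) k.+1 k
  - match k return 'M[C]_(d k) with
    | 0 => 0
    | j.+1 => block (nu na) j.+1 j *m invmx (block Hab j j)
                *m block (nu nb) j j.+1 *m block Ha j.+1 j.+1
    end.
Proof.
pose N := k.+2; have kN : (k < N)%N by []; have k1N : (k.+1 < N)%N by [].
have spectral0 n q (i j : 'I_N) : (i.+1 < j)%N || (j.+1 < i)%N ->
    submxblock (trunc (spectral_sub n q) N) i j = 0.
  by move=> ij; rewrite submxblock_trunc block_spectral_sub0.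
have A0 (i j : 'I_N) : (j.+1 < i)%N ->
    submxblock (trunc (spectral_sub na qa) N) i j = 0.
  by move=> ij; rewrite spectral0 ?ij ?orbT.
have B0 (i j : 'I_N) : (i.+1 < j)%N ->
    submxblock (trunc (spectral_sub nb qb) N) i j = 0.
  by move=> ij; rewrite spectral0 ?ij.
(* The transposed equation has [na] acting from the right and [nb] from the left; [darboux] supplies
   both sides. *)
have := block_toda_tr (gauss_borel_ldu N gb) (gauss_borel_ldu N gba)
  (gauss_borel_ldu N gbb) (gauss_borel_ldu N gbab)
  (fun i j => darboux_mulr i da) (fun i j => darboux_mulr i dab)
  (fun i j => darboux_mull j db) (fun i j => darboux_mull j dba)
  A0 B0 (k := Ordinal kN) k1N.
rewrite !submxblock_trunc/=.
rewrite [in X in _ = X -> _](big_pred1 (Ordinal k1N)); last first.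
  by move=> s; rewrite /= eq_sym -val_eqE.
rewrite !submxblock_trunc/= !block_spectral_sub_neq ?neq_ltn ?ltnSn ?orbT//.
under eq_bigr => s /eqP sk.
  have [ks sk'] : k != s /\ s != k :> nat by lia.
  rewrite !submxblock_trunc/= !block_spectral_sub_neq//; over.
rewrite (sum_ord_succ_eq k (fun s => block (nu na) k s
  *m invmx (block Hab s s) *m block (nu nb) s k *m block Ha k k)).
move=> /(canRL (addrK _)) ->; rewrite addrAC [X in X - _]addrC addKr.
by case: (k).
Qed.
End Toda.
End Spectral.

(** * Bounded measurable functions and integration against charges *)

Section BoundedMeasurable.
Local Open Scope classical_set_scope.
Context d (T : measurableType d) (R : realType).
Implicit Types (f g : T -> R) (h k : T -> R[i]).

(** A class closed under sums and products and integrable against the finite Jordan parts of any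
    charge; the real and imaginary parts of all moment integrands belong to it. *)
Definition bounded_measurable f :=
  measurable_fun setT f /\ exists M, forall x, `|f x| <= M.

Lemma bounded_measurable_cst c : bounded_measurable (fun=> c).
Proof. by split; [exact: measurable_cst|exists `|c|]. Qed.

Lemma bounded_measurableD f g : bounded_measurable f -> bounded_measurable g ->
  bounded_measurable (fun x => f x + g x).
Proof.
move=> [mf [M fM]] [mg [M' gM']]; split; first exact: measurable_realfun.measurable_funD.
exists (M + M') => x; exact: le_trans (ler_normD _ _) (lerD (fM x) (gM' x)).
Qed.

Lemma bounded_measurableM f g : bounded_measurable f -> bounded_measurable g ->
  bounded_measurable (fun x => f x * g x).
Proof.
move=> [mf [M fM]] [mg [M' gM']]; split; first exact: measurable_realfun.measurable_funM.
by exists (M * M') => x; rewrite normrM ler_pM.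
Qed.

Lemma bounded_measurable_integrable f (A : set T)
    (mu : {finite_measure set T -> \bar R}) : measurable A ->
  bounded_measurable f -> mu.-integrable A (EFin \o f).
Proof.
move=> mA [mf [M fM]]; apply: measurable_bounded_integrable => //.
- by rewrite -ge0_fin_numE ?fin_num_measure.
- exact: measurable_funS mf.
- exists M; split; first exact: num_real.
  by move=> M' /ltW MM' x _; exact: le_trans MM'.
Qed.

(** The chosen Hahn decomposition depends on the charge alone, so all three integrals use the same
    two finite measures. *)
Lemma charge_integralD (nu : {charge set T -> \bar R}) (A : set T) f g :
  measurable A -> bounded_measurable f -> bounded_measurable g ->
  charge_integral nu A (fun x => f x + g x) =
  charge_integral nu A f + charge_integral nu A g.
Proof.
move=> mA bf bg; rewrite /charge_integral !RintegralD//;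
  try exact: bounded_measurable_integrable.
by rewrite opprD addrACA.
Qed.

Lemma charge_integralZ (nu : {charge set T -> \bar R}) (A : set T) c f :
  measurable A -> bounded_measurable f ->
  charge_integral nu A (fun x => c * f x) = c * charge_integral nu A f.
Proof.
move=> mA bf; rewrite /charge_integral !RintegralZl//;
  try exact: bounded_measurable_integrable.
by rewrite mulrBr.
Qed.

Definition cbounded_measurable h :=
  bounded_measurable (fun x => complex.Re (h x)) /\
  bounded_measurable (fun x => complex.Im (h x)).

Lemma cbounded_measurable_cst c : cbounded_measurable (fun=> c).
Proof. by split; exact: bounded_measurable_cst. Qed.

Lemma cbounded_measurableD h k : cbounded_measurable h ->
  cbounded_measurable k -> cbounded_measurable (fun x => h x + k x).
Proof.
move=> [hr hi] [kr ki].
by split; under eq_fun do rewrite raddfD/=; exact: bounded_measurableD.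
Qed.

Lemma cbounded_measurableM h k : cbounded_measurable h ->
  cbounded_measurable k -> cbounded_measurable (fun x => h x * k x).
Proof.
have N f : bounded_measurable f -> bounded_measurable (fun x => - f x).
  move=> bf; under eq_fun do rewrite -mulN1r.
  by apply: bounded_measurableM => //; exact: bounded_measurable_cst.
move=> [hr hi] [kr ki]; split.
  rewrite (_ : (fun x => _) = fun x => complex.Re (h x) * complex.Re (k x) +
      - (complex.Im (h x) * complex.Im (k x))).
    by apply: bounded_measurableD; [|apply: N]; exact: bounded_measurableM.
  by apply/funext => x; case: (h x) (k x) => a b [].
rewrite (_ : (fun x => _) = fun x => complex.Re (h x) * complex.Im (k x) +
    complex.Im (h x) * complex.Re (k x)).
  by apply: bounded_measurableD; exact: bounded_measurableM.
by apply/funext => x; case: (h x) (k x) => a b [].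
Qed.

Lemma cbounded_measurable_conj h : cbounded_measurable h ->
  cbounded_measurable (fun x => (h x)^*).
Proof.
move=> [hr hi]; split.
  rewrite (_ : (fun x => _) = fun x => complex.Re (h x))//.
  by apply/funext => x; case: (h x).
rewrite (_ : (fun x => _) = fun x => -1 * complex.Im (h x)).
  by apply: bounded_measurableM => //; exact: bounded_measurable_cst.
by apply/funext => x; rewrite mulN1r; case: (h x).
Qed.

Lemma cbounded_measurable_sum I (r : seq I) (F : I -> T -> R[i]) :
  (forall i, cbounded_measurable (F i)) ->
  cbounded_measurable (fun x => \sum_(i <- r) F i x).
Proof.
move=> bF; elim: r => [|i r IH].
  by under eq_fun do rewrite big_nil; exact: cbounded_measurable_cst.
by under eq_fun do rewrite big_cons; exact: cbounded_measurableD.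
Qed.

Lemma cbounded_measurable_prod I (r : seq I) (F : I -> T -> R[i]) :
  (forall i, cbounded_measurable (F i)) ->
  cbounded_measurable (fun x => \prod_(i <- r) F i x).
Proof.
move=> bF; elim: r => [|i r IH].
  by under eq_fun do rewrite big_nil; exact: cbounded_measurable_cst.
by under eq_fun do rewrite big_cons; exact: cbounded_measurableM.
Qed.

Lemma cbounded_measurableX h m : cbounded_measurable h ->
  cbounded_measurable (fun x => h x ^+ m).
Proof.
move=> bh; elim: m => [|m IH].
  by under eq_fun do rewrite expr0; exact: cbounded_measurable_cst.
by under eq_fun do rewrite exprS; exact: cbounded_measurableM.
Qed.

End BoundedMeasurable.

(** * Integration on the torus and moments of the evolved measures *)

Section TorusIntegral.
Local Open Scope classical_set_scope.
Variables (R : realType) (D : nat) (mu : complex_measure R D).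
Implicit Types (h k w : angles R D -> R[i]) (b : 'I_D) (alpha beta : 'rV[int]_D).

Lemma measurable_torus : measurable (@torus R D).
Proof.
rewrite (_ : @torus R D = \bigcap_(a in [set: 'I_D])
    ((fun theta : angles R D => tnth theta a) @^-1` `[0, 2 * pi[%classic)).
  apply: fin_bigcap_measurable => // a _.
  rewrite -[X in measurable X]setTI; apply: (@measurable_tnth _ _ D a) => //.
apply/seteqP; split=> [theta h a _|theta h a]; first by rewrite /= in_itv /= h.
by have := h a I; rewrite /= in_itv.
Qed.

Lemma torus_integralD h k : cbounded_measurable h -> cbounded_measurable k ->
  torus_integral mu (fun x => h x + k x) =
  torus_integral mu h + torus_integral mu k.
Proof.
move=> [hr hi] [kr ki]; rewrite /torus_integral.
under [fun t => complex.Re _]eq_fun do rewrite raddfD/=.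
under [fun t => complex.Im _]eq_fun do rewrite raddfD/=.
rewrite !charge_integralD//; try exact: measurable_torus.
by apply/eqP; rewrite eq_complex/=; apply/andP; split; apply/eqP; ring.
Qed.

Lemma torus_integralZ c h : cbounded_measurable h ->
  torus_integral mu (fun x => c * h x) = c * torus_integral mu h.
Proof.
case: c => a b [hr hi]; rewrite /torus_integral.
have mt := measurable_torus.
rewrite (_ : (fun t => complex.Re _) =
    fun t => a * complex.Re (h t) + - b * complex.Im (h t)).
  rewrite (_ : (fun t => complex.Im _) =
      fun t => a * complex.Im (h t) + b * complex.Re (h t)).
    rewrite !charge_integralD ?charge_integralZ//;
      try by apply: bounded_measurableM => //; exact: bounded_measurable_cst.
    by apply/eqP; rewrite eq_complex/=; apply/andP; split; apply/eqP; ring.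
  by apply/funext => t; case: (h t).
by apply/funext => t; case: (h t) => u v /=; rewrite mulNr.
Qed.

Lemma torus_integral_sum (I : Type) (r : seq I) (F : I -> angles R D -> R[i]) :
  (forall i, cbounded_measurable (F i)) ->
  torus_integral mu (fun x => \sum_(i <- r) F i x) =
  \sum_(i <- r) torus_integral mu (F i).
Proof.
move=> bF; elim: r => [|i r IH].
  under eq_fun do rewrite big_nil; rewrite big_nil.
  (* The integral of zero is obtained from homogeneity with factor zero. *)
  rewrite -[RHS](mul0r (torus_integral mu (fun=> 0))) -torus_integralZ.
    by congr torus_integral; apply/funext => x; rewrite mul0r.
  exact: cbounded_measurable_cst.
under eq_fun do rewrite big_cons; rewrite big_cons torus_integralD ?IH//.
exact: cbounded_measurable_sum.
Qed.

Lemma zcoord_mul_conj (theta : angles R D) b :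
  zcoord theta b * (zcoord theta b)^* = 1.
Proof.
apply/eqP; rewrite eq_complex/=; apply/andP; split; apply/eqP.
  by rewrite mulrN opprK -!expr2 cos2Dsin2.
by ring.
Qed.

Lemma zcoord_neq0 (theta : angles R D) b : zcoord theta b != 0.
Proof.
apply/eqP => z0; have := zcoord_mul_conj theta b.
by rewrite z0 mul0r => /eqP; rewrite eq_sym oner_eq0.
Qed.

(** On the torus conjugation is inversion, which lets powers of [z] be absorbed on either side of
    the moment matrix. *)
Lemma conj_zcoord (theta : angles R D) b :
  (zcoord theta b)^* = (zcoord theta b)^-1.
Proof.
by apply: (mulfI (zcoord_neq0 theta b)); rewrite zcoord_mul_conj mulfV ?zcoord_neq0.
Qed.

Lemma monomialD alpha beta (theta : angles R D) :
  monomial (alpha + beta) theta = monomial alpha theta * monomial beta theta.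
Proof.
rewrite /monomial -big_split; apply: eq_bigr => a _.
by rewrite mxE expfzDr ?zcoord_neq0.
Qed.

Lemma monomial_delta b (theta : angles R D) :
  monomial (delta_mx 0 b) theta = zcoord theta b.
Proof.
rewrite /monomial (bigD1 b)//= mxE !eqxx expr1z big1 ?mulr1// => a ab.
by rewrite mxE (negPf ab) expr0z.
Qed.

Lemma monomialN alpha (theta : angles R D) :
  monomial (- alpha) theta = (monomial alpha theta)^-1.
Proof.
rewrite /monomial -prodfV; apply: eq_bigr => a _.
by rewrite mxE invr_expz.
Qed.

Lemma cbounded_measurable_zcoord b :
  cbounded_measurable (fun theta : angles R D => zcoord theta b).
Proof.
have mt := @measurable_tnth _ (measurableTypeR R) D b.
split; split=> /=.
- apply: (measurableT_comp _ mt).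
  exact: (measurable_realfun.continuous_measurable_fun (@continuous_cos R)).
- by exists 1 => x; exact: cos_max.
- apply: (measurableT_comp _ mt).
  exact: (measurable_realfun.continuous_measurable_fun (@continuous_sin R)).
- by exists 1 => x; exact: sin_max.
Qed.

Lemma cbounded_measurable_zcoordV b :
  cbounded_measurable (fun theta : angles R D => (zcoord theta b)^-1).
Proof.
under eq_fun do rewrite -conj_zcoord.
by apply: cbounded_measurable_conj; exact: cbounded_measurable_zcoord.
Qed.

Lemma cbounded_measurable_monomial alpha :
  cbounded_measurable (@monomial R D alpha).
Proof.
apply: cbounded_measurable_prod => a; case: (alpha 0 a) => m.
  by apply: cbounded_measurableX; exact: cbounded_measurable_zcoord.
under eq_fun do rewrite NegzE -invr_expz -exprnP -exprVn.
by apply: cbounded_measurableX; exact: cbounded_measurable_zcoordV.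
Qed.

Lemma cbounded_measurable_laurent (n : 'cV[R[i]]_(D + D)) :
  cbounded_measurable (laurent n).
Proof.
apply: cbounded_measurable_sum => b; apply: cbounded_measurableD;
  apply: cbounded_measurableM;
  by [exact: cbounded_measurable_cst|exact: cbounded_measurable_zcoord
     |exact: cbounded_measurable_zcoordV].
Qed.

Lemma cbounded_measurable_evolution (n : 'I_(D + D) -> 'cV[R[i]]_(D + D)) q m :
  cbounded_measurable (evolution n q m).
Proof.
apply: cbounded_measurable_prod => a; apply: cbounded_measurableX.
apply: cbounded_measurableD; first exact: cbounded_measurable_laurent.
exact: cbounded_measurable_cst.
Qed.

(** A factor [z_b] of the integrand can be absorbed into [z^alpha], giving [alpha + e_b], or into
    the conjugate of [z^beta], giving [beta - e_b]. Linearity of the integral then yields the two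
    forms. *)
Lemma moment_darboux n q w : cbounded_measurable w ->
  darboux n q (moment_matrix mu w)
    (moment_matrix mu (fun theta => (laurent n theta - q) * w theta)).
Proof.
move=> bw.
have bm alpha beta : cbounded_measurable
    (fun theta => monomial alpha theta * (monomial beta theta)^* * w theta).
  apply: cbounded_measurableM => //; apply: cbounded_measurableM.
    exact: cbounded_measurable_monomial.
  by apply: cbounded_measurable_conj; exact: cbounded_measurable_monomial.
have bZ c alpha beta : cbounded_measurable
    (fun theta => c * (monomial alpha theta * (monomial beta theta)^* * w theta)).
  by apply: cbounded_measurableM => //; exact: cbounded_measurable_cst.
(* The computation shared by both forms: [u b] and [v b] are the index pairs that absorb [z_b^-1]
   and [z_b]. *)
have lin (u v : 'I_D -> 'rV[int]_D * 'rV[int]_D) alpha beta :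
    (forall (theta : angles R D) b,
       monomial (u b).1 theta * (monomial (u b).2 theta)^* =
       (zcoord theta b)^-1 * (monomial alpha theta * (monomial beta theta)^*)) ->
    (forall (theta : angles R D) b,
       monomial (v b).1 theta * (monomial (v b).2 theta)^* =
       zcoord theta b * (monomial alpha theta * (monomial beta theta)^*)) ->
    moment_matrix mu (fun theta => (laurent n theta - q) * w theta) alpha beta =
    \sum_(b < D) (ncoef_neg n b * moment_matrix mu w (u b).1 (u b).2
      + ncoef_pos n b * moment_matrix mu w (v b).1 (v b).2)
    - q * moment_matrix mu w alpha beta.
  move=> hu hv; rewrite /moment_matrix.
  under eq_bigr do rewrite -!torus_integralZ// -torus_integralD//.
  rewrite -mulNr -torus_integralZ// -torus_integral_sum => [|b]; last first.
    exact: cbounded_measurableD.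
  rewrite -torus_integralD//; last first.
    by apply: cbounded_measurable_sum => b; exact: cbounded_measurableD.
  congr torus_integral; apply/funext => theta.
  rewrite /laurent mulrBl mulr_suml mulrBr mulr_sumr mulNr.
  congr (_ - _); last by ring.
  by apply: eq_bigr => b _; rewrite hu hv; ring.
split=> alpha beta.
  apply: (lin (fun b => (alpha - delta_mx 0 b, beta))
              (fun b => (alpha + delta_mx 0 b, beta))) => theta b /=.
    by rewrite monomialD monomialN monomial_delta; ring.
  by rewrite monomialD monomial_delta; ring.
apply: (lin (fun b => (alpha, beta + delta_mx 0 b))
            (fun b => (alpha, beta - delta_mx 0 b))) => theta b /=.
  by rewrite monomialD monomial_delta rmorphM/= conj_zcoord; ring.
by rewrite monomialD monomialN monomial_delta rmorphM/= -conj_zcoord conjCK; ring.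
Qed.

End TorusIntegral.

(** * Discrete times and the Toda equations *)

Lemma gauss_borel_HP (C : numClosedFieldType) D (G : smatrix C D) :
  (forall k, (1 <= k)%N -> \det (trunc G k) != 0) ->
  exists S Sh, gauss_borel G S (gauss_borel_H G) Sh.
Proof.
move=> Gqd.
have Gu k : trunc G k \in unitmx.
  case: k => [|k]; first exact: trunc0_unit.
  by rewrite unitmxE unitfE Gqd.
(* Existence guarantees that [xget] returns a genuine factor and not its default, the zero
   matrix. *)
exact: (xgetPex (fun _ _ => 0) (gauss_borel_exists Gu)).
Qed.

(** This identifies a unit step in one discrete time with a Darboux step on the moment matrices. *)
Lemma evolution_shift (R : realType) D (n : 'I_(D + D) -> 'cV[R[i]]_(D + D))
    q m a :
  evolution n q (fun c => (m c + (c == a))%N) =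
  fun theta => (laurent (n a) theta - q a) * evolution n q m theta.
Proof.
apply/funext => theta; rewrite /evolution mulrC.
under eq_bigr do rewrite exprD.
rewrite big_split/=; congr (_ * _); rewrite (bigD1 a)//= eqxx expr1.
by rewrite big1 ?mulr1// => c /negPf ->; rewrite expr0.
Qed.

Theorem corollary4p1 (R : realType) (D : nat) (hD : (1 <= D)%N)
    (mu : complex_measure R D)
    (n : 'I_(D + D) -> 'cV[R[i]]_(D + D)) (q : 'I_(D + D) -> R[i])
    (hn : free [tuple n a | a < D + D])
    (hqd : forall m : 'I_(D + D) -> nat, quasi_definite mu (evolution n q m))
    (a b : 'I_(D + D)) (ha : (a < D)%N) (hb : (b < D)%N)
    (k : nat) (m : 'I_(D + D) -> nat) :
  let nu := fun c => spectral_nu (n c) in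
  let H := Hblock mu n q in
  let T := fun c j => Tshift c (H j) in
  let TT := fun c d j => Tshift c (Tshift d (H j)) in
  Tdiff b (fun p => T a k p *m invmx (H k p)) m =
    block (nu a) k k.+1 *m H k.+1 m *m block (nu b) k.+1 k
      *m invmx (T b k m)
    - match k return 'M[R[i]]_(size (shell D k)) with
      | 0 => 0
      | j.+1 => T a j.+1 m *m block (nu b) j.+1 j *m invmx (TT a b j m)
                  *m block (nu a) j j.+1
      end
  /\
  Tdiff b (fun p => invmx (H k p) *m T a k p) m =
    invmx (T b k m) *m block (nu b) k k.+1 *m H k.+1 m
      *m block (nu a) k.+1 k
    - match k return 'M[R[i]]_(size (shell D k)) with
      | 0 => 0
      | j.+1 => block (nu a) j.+1 j *m invmx (TT a b j m)
                  *m block (nu b) j j.+1 *m T a j.+1 m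
      end.
Proof.
move=> nu H T TT.
pose G p := moment_matrix mu (evolution n q p).
pose s c (p : 'I_(D + D) -> nat) := fun c' => (p c' + (c' == c))%N.
have dG c p : darboux (n c) (q c) (G p) (G (s c p)).
  rewrite /G evolution_shift; apply: moment_darboux.
  exact: cbounded_measurable_evolution.
(* The doubly shifted moment matrix is reached in either order, which closes the square of four
   factorizations. *)
have sC : s b (s a m) = s a (s b m) by apply/funext => c; rewrite /s addnAC.
have gb_H p := gauss_borel_HP (hqd p).
have [S [Sh gb]] := gb_H m.
have [Sa [Sha gba]] := gb_H (s a m).
have [Sb [Shb gbb]] := gb_H (s b m).
have [Sab [Shab gbab]] := gb_H (s a (s b m)).
have dba : darboux (n b) (q b) (G (s a m)) (G (s a (s b m))) by rewrite -sC.
have TTE j : TT a b j m = H j (s a (s b m)) by rewrite -sC.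
have toda_left :=
  smatrix_toda_left gb gba gbb gbab (dG a m) (dG a (s b m)) (dG b m) dba k.
have toda_right :=
  smatrix_toda_right gb gba gbb gbab (dG a m) (dG a (s b m)) (dG b m) dba k.
split; [refine (etrans toda_left _)|refine (etrans toda_right _)];
  by case: (k) => [|j]; rewrite ?TTE; exact: erefl.
Qed.
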